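(* Let $\mathcal{A}$ be a unital C*-algebra and let $\mathcal{A}^+ := \{a^*a : a \in \mathcal{A}\}$ be the set of all positive elements of $\mathcal{A}$. Let $d, n \in \mathbb{N}$, $\theta \in [0, 2\pi)$, and let $\{\tau_j\}_{j=1}^n$ be a noncommutative $(d,n,\theta)$-spherical code in $\mathcal{A}^d$. Let $c \in (0,\infty)$ and let $\phi : \mathcal{A}^+ \to \mathbb{R}$ be a function satisfying the following: (i) $\sum_{1 \leq j,k \leq n} \phi(\langle \tau_j - \tau_k, \tau_j - \tau_k \rangle) \geq 0$; (ii) $\phi(a) + c \leq 0$ for all $a \in \mathcal{A}^+$ with $a \geq 2(1 - \cos\theta)$. Then $$ n \leq \frac{\phi(0) + c}{c}. $$ In particular, if $\phi(0) + c \leq 1$, then $n \leq 1/c$.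
   Context: $\mathbb{N} = \{1,2,3,\dots\}$. For a unital C*-algebra $\mathcal{A}$ and $d \in \mathbb{N}$, $\mathcal{A}^d$ denotes the standard left Hilbert C*-module with $\mathcal{A}$-valued inner product $\langle (a_j)_{j=1}^d, (b_j)_{j=1}^d \rangle := \sum_{j=1}^d a_j b_j^*$ and norm $\|(a_j)_{j=1}^d\| := \left\| \sum_{j=1}^d a_j a_j^* \right\|^{1/2}$. The order on self-adjoint elements is the usual C*-algebra order ($a \geq b$ iff $a - b \in \mathcal{A}^+$), and a real number $r$ is identified with $r \cdot 1 \in \mathcal{A}$. Definition: for $d \in \mathbb{N}$ and $\theta \in [0,2\pi)$, a collection $\{\tau_j\}_{j=1}^n$ of vectors in $\mathcal{A}^d$ is a noncommutative $(d,n,\theta)$-spherical code (or $(d,n,\theta)$-modular code) in $\mathcal{A}^d$ if (a) $\langle \tau_j, \tau_j \rangle = 1$ for all $1 \leq j \leq n$; and (b) $2 - \langle \tau_j, \tau_k \rangle - \langle \tau_k, \tau_j \rangle = \langle \tau_j - \tau_k, \tau_j - \tau_k \rangle \geq 2(1 - \cos\theta)$ in $\mathcal{A}$ for all $1 \leq j,k \leq n$ with $j \neq k$. *)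

(* Defs.v *)
From HB Require Import structures.
From mathcomp Require Import all_boot all_order all_algebra.
From mathcomp Require Import complex.
From mathcomp Require Import all_classical all_reals all_analysis.

Set Implicit Arguments.
Unset Strict Implicit.
Unset Printing Implicit Defensive.

Import Order.TTheory GRing.Theory Num.Theory numFieldNormedType.Exports.
Local Open Scope ring_scope.
Local Open Scope complex_scope.
Local Open Scope classical_set_scope.

(* A structure inheriting from both a ring and a normed module cannot be
   declared with HB: numDomainType already inherits from both, so HB requires
   a join that had to be declared before it. The product is therefore given by
   fields over a complete normed complex space, and the library ring structure
   is put on the carrier afterwards. Norms take their (nonnegative real) values
   in R[i]. 1 != 0 is not required: the zero algebra is allowed. *)
Record unitalCStarAlgebra (R : realType) := UnitalCStarAlgebra {
  cstar_space : completeNormedModType R[i] ;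
  cstar_one : cstar_space ;
  cstar_mul : cstar_space -> cstar_space -> cstar_space ;
  cstar_adj : cstar_space -> cstar_space ;
  cstar_mulA : associative cstar_mul ;
  cstar_mul1 : left_id cstar_one cstar_mul ;
  cstar_mulr1 : right_id cstar_one cstar_mul ;
  cstar_mulDl : left_distributive cstar_mul +%R ;
  cstar_mulDr : right_distributive cstar_mul +%R ;
  cstar_scaleAl : forall (k : R[i]) x y,
    k *: cstar_mul x y = cstar_mul (k *: x) y ;
  cstar_scaleAr : forall (k : R[i]) x y,
    k *: cstar_mul x y = cstar_mul x (k *: y) ;
  cstar_normM_le : forall x y, `|cstar_mul x y| <= `|x| * `|y| ;
  cstar_adjD : {morph cstar_adj : x y / x + y} ;
  cstar_adjZ : forall (k : R[i]) x, cstar_adj (k *: x) = k^* *: cstar_adj x ;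
  cstar_adjM : forall x y,
    cstar_adj (cstar_mul x y) = cstar_mul (cstar_adj y) (cstar_adj x) ;
  cstar_adjK : involutive cstar_adj ;
  cstar_normE : forall x, `|cstar_mul (cstar_adj x) x| = `|x| ^+ 2
}.

Definition cstar_sort (R : realType) (A : unitalCStarAlgebra R) : Type :=
  cstar_space A.

Coercion cstar_sort : unitalCStarAlgebra >-> Sortclass.

HB.instance Definition _ (R : realType) (A : unitalCStarAlgebra R) :=
  CompleteNormedModule.copy (cstar_sort A) (cstar_space A).

HB.instance Definition _ (R : realType) (A : unitalCStarAlgebra R) :=
  GRing.Zmodule_isPzRing.Build (cstar_sort A)
    (@cstar_mulA R A) (@cstar_mul1 R A) (@cstar_mulr1 R A)
    (@cstar_mulDl R A) (@cstar_mulDr R A).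

Section CStarAlgebra.
Variables (R : realType) (A : unitalCStarAlgebra R).
Implicit Types (a b x y : A) (k : R[i]).

Definition adj : A -> A := @cstar_adj R A.

Lemma scaleAl k x y : k *: (x * y) = (k *: x) * y.
Proof. exact: cstar_scaleAl. Qed.

Lemma scaleAr k x y : k *: (x * y) = x * (k *: y).
Proof. exact: cstar_scaleAr. Qed.

Lemma normM_le x y : `|x * y| <= `|x| * `|y|.
Proof. exact: cstar_normM_le. Qed.

Lemma adjD : {morph adj : x y / x + y}.
Proof. exact: cstar_adjD. Qed.

Lemma adjZ k x : adj (k *: x) = k^* *: adj x.
Proof. exact: cstar_adjZ. Qed.

Lemma adjM x y : adj (x * y) = adj y * adj x.
Proof. exact: cstar_adjM. Qed.

Lemma adjK : involutive adj.
Proof. exact: cstar_adjK. Qed.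

Lemma norm_adjM x : `|adj x * x| = `|x| ^+ 2.
Proof. exact: cstar_normE. Qed.

Definition cstar_pos : set A := [set adj a * a | a in setT].

Definition cstar_le a b : Prop := cstar_pos (b - a).

Definition cstar_real (r : R) : A := r%:C *: (1 : A).

(* The A-valued inner product of the standard left Hilbert C*-module A^d,
   which is A-linear in the first variable. *)
Definition mod_inner (d : nat) (u v : 'rV[A]_d) : A :=
  \sum_(j < d) u ord0 j * adj (v ord0 j).

Definition modular_code (d n : nat) (theta : R) (tau : 'I_n -> 'rV[A]_d) :=
  (forall j : 'I_n, mod_inner (tau j) (tau j) = 1) /\
  (forall j k : 'I_n, j != k ->
     cstar_le (cstar_real (2 * (1 - cos theta)))
              (mod_inner (tau j - tau k) (tau j - tau k))).

End CStarAlgebra.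

(* Main.v *)
(* Off the diagonal [phi] is at most [-c], so summing over all pairs gives
   [0 <= n phi(0) - n (n - 1) c], which is the bound. Since [phi] is only
   constrained on [A^+], this uses that [<u, u> = sum_j u_j u_j^*] has the form
   [a^* a], i.e. that sums of positive elements are positive.

   That fact is obtained without spectral theory. Call [h = h^*] positive if
   [||t - h|| <= t] for some [t >= 0]: this is stable under sums, and such an [h]
   has a square root given by the iteration [y := (k + y^2) / 2], whose
   limit satisfies [(1 - y)^2 = 1 - k]. Squares of self-adjoint elements are
   positive because [w + i sqrt (||w||^2 - w^2)] is a multiple of a unitary, and
   [b^* b] is positive by the Fukamiya-Kelley-Vaught argument. *)
Require Import Defs.
From mathcomp Require Import all_boot all_order all_algebra.
From mathcomp Require Import complex.
From mathcomp Require Import all_classical all_reals all_analysis.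
From mathcomp Require Import ring lra.
Import Order.TTheory GRing.Theory Num.Theory numFieldNormedType.Exports.
Local Open Scope ring_scope.
Local Open Scope complex_scope.
Local Open Scope classical_set_scope.

Section CStarPositive.
Set Implicit Arguments.
Unset Strict Implicit.
Unset Printing Implicit Defensive.

Variables (R : realType) (A : unitalCStarAlgebra R).
Implicit Types (a b h k u v w x y z : A) (r s t m : R).
Local Notation adj := (@adj R A).
Local Notation "r *! x" := (r%:C *: x) (at level 40).
Local Notation "\1" := (1 : A).

(** * Real-valued norm and the adjoint *)

(** The norm is a nonnegative real inside [R[i]], so its real part loses nothing and moves all
    estimates to [R]. *)
Definition rnorm x : R := complex.Re `|x|.

Lemma rnormE x : (rnorm x)%:C = `|x|.
Proof. by rewrite /rnorm RRe_real // ger0_real. Qed.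

Lemma rnorm_ge0 x : 0 <= rnorm x.
Proof. by rewrite -ler0c rnormE. Qed.

Lemma rnormD x y : rnorm (x + y) <= rnorm x + rnorm y.
Proof. by rewrite -lecR rmorphD /= !rnormE ler_normD. Qed.

Lemma rnormN x : rnorm (- x) = rnorm x.
Proof. by rewrite /rnorm normrN. Qed.

Lemma rnormB x y : rnorm (x - y) <= rnorm x + rnorm y.
Proof. by rewrite -(rnormN y) rnormD. Qed.

Lemma rnorm_distC x y : rnorm (x - y) = rnorm (y - x).
Proof. by rewrite -rnormN opprB. Qed.

Lemma rnormM x y : rnorm (x * y) <= rnorm x * rnorm y.
Proof. by rewrite -lecR rmorphM /= !rnormE normM_le. Qed.

Lemma rnormZ r x : 0 <= r -> rnorm (r *! x) = r * rnorm x.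
Proof.
move=> r0; apply: (@complexI R); rewrite rnormE normrZ ger0_norm ?ler0c //.
by rewrite -rnormE -rmorphM.
Qed.

Lemma rnorm_iZ x : rnorm ('i%C *: x) = rnorm x.
Proof.
apply: (@complexI R); rewrite !rnormE normrZ normc_def /=.
by rewrite expr0n expr1n add0r sqrtr1 mul1r.
Qed.

Lemma rnorm0 : rnorm 0 = 0.
Proof. by rewrite /rnorm normr0. Qed.

Lemma rnorm0_eq0 x : rnorm x = 0 -> x = 0.
Proof. by move=> x0; apply/normr0_eq0; rewrite -rnormE x0. Qed.

Lemma rnorm_adjM x : rnorm (adj x * x) = rnorm x ^+ 2.
Proof. by apply: (@complexI R); rewrite rmorphXn /= !rnormE norm_adjM. Qed.

Lemma rnorm_adj_le x : rnorm x <= rnorm (adj x).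
Proof.
have [x0|x0] := eqVneq (rnorm x) 0; first by rewrite x0 rnorm_ge0.
have xp : 0 < rnorm x by rewrite lt_def x0 rnorm_ge0.
by rewrite -(ler_pM2r xp) -expr2 -rnorm_adjM rnormM.
Qed.

Lemma rnorm_adj x : rnorm (adj x) = rnorm x.
Proof.
by apply/le_anti; rewrite rnorm_adj_le -{2}(adjK x) rnorm_adj_le.
Qed.

Lemma adj_one : adj 1 = 1.
Proof. by rewrite -[LHS]mulr1 -{2}(adjK 1) -adjM mulr1 adjK. Qed.

Lemma adj_zero : adj 0 = 0.
Proof. by apply: (addrI (adj 0)); rewrite -adjD !addr0. Qed.

Lemma adjN x : adj (- x) = - adj x.
Proof. by apply: (addrI (adj x)); rewrite -adjD !subrr adj_zero. Qed.

Lemma adjB x y : adj (x - y) = adj x - adj y.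
Proof. by rewrite adjD adjN. Qed.

Lemma adjZr r x : adj (r *! x) = r *! adj x.
Proof. by rewrite Defs.adjZ; congr (_ *: _); exact: (conjc_real r). Qed.

(** The norm of [1] is its own square, so it is [1], or [0] in the zero algebra. *)
Lemma rnorm1_le : rnorm 1 <= 1.
Proof.
have := rnorm_adjM 1; rewrite adj_one mulr1 => n1.
have [->|n0] := eqVneq (rnorm 1) 0; first exact: ler01.
have /(mulfI n0) -> // : rnorm 1 * rnorm 1 = rnorm 1 * 1.
by rewrite mulr1 -expr2 -n1.
Qed.

Lemma scaler_rD r s x : (r + s) *! x = r *! x + s *! x.
Proof. by rewrite rmorphD scalerDl. Qed.

Lemma scaler_rM r s x : r *! (s *! x) = (r * s) *! x.
Proof. by rewrite scalerA -rmorphM. Qed.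

Lemma scaler_r1 x : 1 *! x = x.
Proof. exact: scale1r. Qed.

Lemma scaler_half x : 2^-1 *! (x + x) = x.
Proof.
rewrite -{1 2}(scaler_r1 x) -scaler_rD scaler_rM -[RHS]scaler_r1.
by congr (_%:C *: _); lra.
Qed.

(** * Limits of majorised sequences *)

Lemma rnorm_small_eq0 x (C : R) :
  (forall e, 0 < e -> rnorm x <= C * e) -> x = 0.
Proof.
move=> H; apply/rnorm0_eq0/le_anti; rewrite rnorm_ge0 andbT leNgt.
apply/negP => xp; have C0 : 0 < `|C| + 1 by rewrite ltr_pwDr.
have e0 : 0 < rnorm x / (`|C| + 1) by rewrite divr_gt0.
have : (`|C| + 1) * (rnorm x / (`|C| + 1)) = rnorm x.
  by rewrite mulrC divfK // gt_eqF.
by have := H _ e0; have := ler_norm C; nra.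
Qed.

(** The majorant [r] is nondecreasing and bounded, so its tails are small; telescoping makes [y]
    Cauchy, and completeness gives the limit. *)
Lemma cvg_dominated (y : nat -> A) (r : nat -> R) (B : R) :
  (forall n, r n <= B) ->
  (forall n, rnorm (y n.+1 - y n) <= r n.+1 - r n) ->
  exists l, forall e, 0 < e ->
    exists N, forall n, (N <= n)%N -> rnorm (y n - l) <= e.
Proof.
move=> rB yr.
have tele p n : rnorm (y (n + p)%N - y n) <= r (n + p)%N - r n.
  elim: p => [|p IH]; first by rewrite addn0 !subrr rnorm0.
  rewrite addnS -(subrKA (y (n + p)%N)).
  by apply: le_trans (rnormD _ _) _; have := yr (n + p)%N; lra.
have ri n p : (n <= p)%N -> r n <= r p.
  by move=> /subnKC <-; rewrite -subr_ge0; apply: le_trans (tele _ _);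
    exact: rnorm_ge0.
have tailr e : 0 < e -> exists N, forall n, (N <= n)%N -> r n - r N < e.
  move=> e0.
  have hs : has_sup (range r)
    by split; [exists (r 0%N), 0%N | exists B => _ [n _ <-]].
  have [_ [N _ <-] hN] := sup_adherent e0 hs.
  exists N => n _; have : r n <= sup (range r).
    by apply: ub_le_sup; [exact: (proj2 hs)|exists n].
  lra.
have /cauchy_cvgP/cvg_ex[l /cvgrPdistC_le yl] :
    cauchy ((y : nat -> cstar_space A) @ \oo).
  (* Positivity in [R[i]] forces [e] to be real; [e1] records this. *)
  apply: cauchy_exP => e; rewrite ltcE => /andP[/eqP /= e1 e2].
  have [N hN] := tailr _ e2.
  exists (y N); exists N => // n /= Nn.
  rewrite -ball_normE /= distrC.
  rewrite -[X in X < _]rnormE ltcE /= e1 eqxx /=.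
  apply: le_lt_trans (hN n Nn).
  by rewrite -(subnKC Nn) tele.
exists l => e e0.
have /yl[N _ hN] : 0 < e%:C by rewrite ltcR.
by exists N => n /hN; rewrite /= -[X in X <= _]rnormE lecR.
Qed.

(** * Iteration for the square root *)

Fixpoint sqrt_iter k n : A :=
  if n is n'.+1 then 2^-1 *! (k + sqrt_iter k n' * sqrt_iter k n') else 0.

(** The same iteration for the scalar [k = 1], bounded by its fixed point [1]. *)
Fixpoint sqrt_iter_bound n : R :=
  if n is n'.+1 then (1 + sqrt_iter_bound n' ^+ 2) / 2 else 0.

Lemma sqrt_iter_bound01 n : 0 <= sqrt_iter_bound n <= 1.
Proof.
elim: n => [|n /andP[r0 r1]] /=; first by rewrite lexx ler01.
by apply/andP; split; nra.
Qed.

Lemma subr_sqr_ncomm x y : y * y - x * x = y * (y - x) + (y - x) * x.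
Proof. by rewrite mulrBr mulrBl subrKA. Qed.

Lemma rnorm_subr_sqr x y (B C D : R) :
  rnorm x <= B -> rnorm y <= C -> rnorm (y - x) <= D ->
  rnorm (y * y - x * x) <= (C + B) * D.
Proof.
move=> xB yC D_; rewrite subr_sqr_ncomm; apply: le_trans (rnormD _ _) _.
have := rnormM y (y - x); have := rnormM (y - x) x.
have := rnorm_ge0 x; have := rnorm_ge0 y; have := rnorm_ge0 (y - x).
by nra.
Qed.

Lemma sqrt_iter_le k n : rnorm k <= 1 ->
  rnorm (sqrt_iter k n) <= sqrt_iter_bound n.
Proof.
move=> k1; elim: n => [|n IH] /=; first by rewrite rnorm0.
rewrite rnormZ ?invr_ge0 // mulrC ler_pM2r ?invr_gt0 //.
apply: le_trans (rnormD _ _) _; apply: lerD => //.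
apply: le_trans (rnormM _ _) _; have := rnorm_ge0 (sqrt_iter k n); nra.
Qed.

(** Consecutive steps differ by half a difference of squares, split without commutativity as
    [y (y - x) + (y - x) x]; the majorant obeys the same recursion with equality. *)
Lemma sqrt_iter_diff k n : rnorm k <= 1 ->
  rnorm (sqrt_iter k n.+1 - sqrt_iter k n) <=
  sqrt_iter_bound n.+1 - sqrt_iter_bound n.
Proof.
move=> k1; elim: n => [|n IH].
  rewrite /= mulr0 addr0 subr0 rnormZ ?invr_ge0 // expr0n /=; lra.
have -> : sqrt_iter k n.+2 - sqrt_iter k n.+1 =
    2^-1 *! (sqrt_iter k n.+1 * sqrt_iter k n.+1 -
             sqrt_iter k n * sqrt_iter k n).
  by rewrite /= -scalerBr opprD addrACA subrr add0r.
rewrite rnormZ ?invr_ge0 //.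
have H := rnorm_subr_sqr (sqrt_iter_le n k1)
  (sqrt_iter_le n.+1 k1) IH.
rewrite [sqrt_iter_bound n.+2]/= -/(sqrt_iter_bound n.+1).
move: H; rewrite -/(sqrt_iter k n.+1).
set r1 := sqrt_iter_bound n.+1; set r0 := sqrt_iter_bound n.
have -> : (1 + r1 ^+ 2) / 2 - r1 = (r1 + r0) * (r1 - r0) / 2.
  by rewrite /r1 /= -/r0; field.
by lra.
Qed.

Lemma sqrt_iter_adj k n : adj k = k -> adj (sqrt_iter k n) = sqrt_iter k n.
Proof.
by move=> ka; elim: n => [|n IH] /=; rewrite ?adj_zero // adjZr adjD adjM IH ka.
Qed.

Lemma sqrt_iter_comm k z n :
  z * k = k * z -> z * sqrt_iter k n = sqrt_iter k n * z.
Proof.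
move=> zk; elim: n => [|n IH] /=; first by rewrite mulr0 mul0r.
by rewrite -scaleAr -scaleAl mulrDr mulrDl mulrA IH -mulrA IH mulrA zk.
Qed.

(** Each property passes to the limit from the iterates; the third one says [(1 - y)^2 = 1 - k]. *)
Lemma exists_sqrt1B k : adj k = k -> rnorm k <= 1 ->
  exists y, [/\ adj y = y, rnorm y <= 1, y + y = k + y * y &
    forall z, z * k = k * z -> z * y = y * z].
Proof.
move=> ka k1.
have [n|n|l hl] := @cvg_dominated (sqrt_iter k) sqrt_iter_bound 1.
- by case/andP: (sqrt_iter_bound01 n).
- exact: sqrt_iter_diff.
have y1 n : rnorm (sqrt_iter k n) <= 1.
  by apply: le_trans (sqrt_iter_le _ k1) _; case/andP: (sqrt_iter_bound01 n).
have l1 : rnorm l <= 1.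
  apply/ler_addgt0Pr => e /hl[N /(_ N (leqnn N))]; rewrite rnorm_distC => lN.
  rewrite -(subrK (sqrt_iter k N) l); apply: le_trans (rnormD _ _) _.
  by have := y1 N; lra.
exists l; split => //.
- apply/eqP; rewrite -subr_eq0; apply/eqP.
  apply: (@rnorm_small_eq0 _ 2) => e /hl[N /(_ N (leqnn N)) lN].
  rewrite -(subrKA (sqrt_iter k N)) -{1}(sqrt_iter_adj N ka) -adjB.
  apply: le_trans (rnormD _ _) _; rewrite rnorm_adj rnorm_distC; lra.
- apply/eqP; rewrite -subr_eq0; apply/eqP.
  (* The two terms [l - y'] cost [2 e], and the difference of squares costs [(1 + 1) e]. *)
  apply: (@rnorm_small_eq0 _ 4) => e /hl[N lN].
  have lN0 := lN N (leqnn N); have := lN N.+1 (leqnSn N).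
  set y' := sqrt_iter k N.+1; set y := sqrt_iter k N => lN1.
  have yy : y' + y' = k + y * y.
    by rewrite /y' /= -scalerDr scaler_half.
  have -> : l + l - (k + l * l) = (l - y') + (l - y') + (y * y - l * l).
    by rewrite [X in _ = X + _]addrACA -opprD yy !opprD !addrA subrK.
  apply: le_trans (rnormD _ _) _.
  have := rnorm_subr_sqr l1 (y1 N) lN0.
  have := rnormD (l - y') (l - y').
  by rewrite [rnorm (l - y')]rnorm_distC -/y; lra.
- move=> z zk; apply/eqP; rewrite -subr_eq0; apply/eqP.
  apply: (@rnorm_small_eq0 _ (2 * rnorm z)) => e /hl[N /(_ N (leqnn N))].
  have := sqrt_iter_comm N zk; set y := sqrt_iter k N => zy lN.
  have -> : z * l - l * z = (y - l) * z - z * (y - l).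
    by rewrite mulrBl mulrBr zy opprB [RHS]addrC subrKA.
  apply: le_trans (rnormB _ _) _.
  have := rnormM (y - l) z; have := rnormM z (y - l).
  by have := rnorm_ge0 z; nra.
Qed.

(** * Positive elements and their square roots *)

(** For a real scalar [h] the norm condition reads [0 <= h <= 2 t]; in general it confines the
    spectrum of [h] to that interval. *)
Definition psd h :=
  adj h = h /\ exists2 t : R, 0 <= t & rnorm (t *! \1 - h) <= t.

(** For [t > 0], [k = 1 - h / t] has norm at most [1], and the root is [sqrt t (1 - y)] with [y] the
    limit of the iteration for [k]. Commutation with whatever commutes with [h] stands in for
    functional calculus later. *)
Lemma psd_sqrt h : psd h -> exists a, [/\ psd a, a * a = h &
  forall z, z * h = h * z -> z * a = a * z].
Proof.
move=> [ha [t t0 th]].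
have [tE|tn0] := eqVneq t 0.
  exists 0; suff -> : h = 0.
    split=> [||z _]; rewrite ?mulr0 ?mul0r //; split; first exact: adj_zero.
    by exists 0; rewrite ?lexx // scale0r subr0 rnorm0.
  move: th; rewrite tE scale0r sub0r rnormN => h0.
  by apply/rnorm0_eq0/le_anti; rewrite h0 rnorm_ge0.
have tp : 0 < t by rewrite lt_def tn0.
have [||y [ya y1 yE yc]] := @exists_sqrt1B (t^-1 *! (t *! \1 - h)).
- by rewrite adjZr adjB adjZr adj_one ha.
- by rewrite rnormZ ?invr_ge0 // mulrC ler_pdivrMr ?mul1r.
exists (Num.sqrt t *! (1 - y)); split.
- split; first by rewrite adjZr adjB adj_one ya.
  exists (Num.sqrt t); first exact: sqrtr_ge0.
  rewrite -scalerBr opprB addrC subrK rnormZ ?sqrtr_ge0 //.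
  by rewrite -[leRHS]mulr1 ler_wpM2l ?sqrtr_ge0.
- rewrite -scaleAl -scaleAr scaler_rM -expr2 sqr_sqrtr //.
  rewrite mulrBl mul1r mulrBr mulr1 opprB addrACA -opprD yE opprD.
  rewrite [- _ - _]addrC addrA addrK.
  by rewrite scalerBr scaler_rM divff // scaler_r1 opprB addrC subrK.
- move=> z zh; rewrite -scaleAl -scaleAr mulrBl mulrBr mul1r mulr1 yc //.
  by rewrite -scaleAl -scaleAr mulrBl mulrBr -scaleAl -scaleAr mul1r mulr1 zh.
Qed.

Lemma psdD h k : psd h -> psd k -> psd (h + k).
Proof.
move=> [ha [t t0 th]] [ka [s s0 sk]]; split; first by rewrite adjD ha ka.
exists (t + s); first by rewrite addr_ge0.
rewrite scaler_rD opprD addrACA; apply: le_trans (rnormD _ _) _.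
exact: lerD.
Qed.

Lemma psd_half h : psd (h + h) -> psd h.
Proof.
move=> [ha [t t0 th]]; split.
  by rewrite -(scaler_half h) adjZr ha.
exists (2^-1 * t); first by rewrite mulr_ge0 ?invr_ge0.
rewrite -(scaler_half h) -scaler_rM -scalerBr rnormZ ?invr_ge0 //.
by rewrite ler_pM2l ?invr_gt0.
Qed.

(** * Squares of self-adjoint elements *)

Lemma rnormDD x : rnorm (x + x) = 2 * rnorm x.
Proof. by rewrite -{1 2}(scaler_r1 x) -scaler_rD rnormZ //; lra. Qed.

(* [w + i a] is [sqrt m] times a unitary; [a] and [w a] are read off the
   imaginary parts of it and of its square. *)
Lemma rnorm_pythagoras w a m : adj w = w -> adj a = a -> w * a = a * w ->
  0 <= m -> w * w + a * a = m *! \1 ->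
  rnorm a ^+ 2 <= m /\ rnorm (w * a) <= m / 2.
Proof.
move=> wa aa wac m0 E.
set p := 'i%C *: a; set u := w + p; set v := w - p.
have pp : p * p = - (a * a).
  by rewrite -scaleAl -scaleAr scalerA -expr2 sqr_i scaleN1r.
have wp : w * p = p * w by rewrite -scaleAl -scaleAr wac.
have pn : adj p = - p.
  by rewrite Defs.adjZ aa -scaleNr; congr (_ *: _);
    rewrite /= /GRing.opp /= oppr0.
have vE : adj u = v by rewrite adjD wa pn.
have vu : v * u = m *! \1.
  by rewrite mulrBl !mulrDr wp opprD addrA addrK pp opprK.
have un : rnorm u ^+ 2 <= m.
  rewrite -rnorm_adjM vE vu rnormZ // -[leRHS]mulr1 ler_wpM2l //.
  exact: rnorm1_le.
have vn : rnorm v = rnorm u by rewrite -vE rnorm_adj.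
have pa : rnorm p = rnorm a by rewrite rnorm_iZ.
split.
  have : rnorm (p + p) <= rnorm u + rnorm v.
    have -> : p + p = u - v by rewrite /u /v opprB [RHS]addrC addrA subrK.
    exact: rnormB.
  by rewrite rnormDD vn pa; have := rnorm_ge0 a; nra.
have : rnorm ((w * p + w * p) + (w * p + w * p)) <= m + m.
  have -> : (w * p + w * p) + (w * p + w * p) = u * u - v * v.
    rewrite /u /v mulrBl !mulrBr mulrDl !mulrDr -wp.
    set q := w * p; set ww := w * w; set pq := p * p.
    rewrite !opprB [q - pq + _]addrC [RHS]addrACA [ww + q]addrC.
    by rewrite [q + ww + _]addrACA [q + pq + _]addrACA !subrr !addr0.
  apply: le_trans (rnormB _ _) _; apply: lerD.
    by apply: le_trans (rnormM _ _) _; rewrite -expr2.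
  by apply: le_trans (rnormM _ _) _; rewrite vn -expr2.
rewrite !rnormDD -scaleAr rnorm_iZ; lra.
Qed.

(** Since [||w^2|| <= ||w||^2], the element [||w||^2 - w^2] is [psd] with [t = ||w||^2]; [a] is its
    root. *)
Lemma sqr_complement w : adj w = w -> exists a,
  [/\ adj a = a, w * a = a * w & w * w + a * a = (rnorm w ^+ 2) *! \1].
Proof.
move=> wa; have [|a [[aa _] aE ac]] := @psd_sqrt ((rnorm w ^+ 2) *! \1 - w * w).
  split; first by rewrite adjB adjZr adj_one adjM wa.
  exists (rnorm w ^+ 2); first exact: sqr_ge0.
  by rewrite opprB addrC subrK expr2 rnormM.
exists a; split => //; last by rewrite aE addrC subrK.
by apply: ac; rewrite mulrBl mulrBr -scaleAl -scaleAr mul1r mulr1 mulrA.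
Qed.

(** The element on the left is [a^2] for the complement [a] of [w], and [||a||^2 <= ||w||^2]. *)
Lemma rnorm_sqr_le w : adj w = w ->
  rnorm ((rnorm w ^+ 2) *! \1 - w * w) <= rnorm w ^+ 2.
Proof.
move=> wa; have [a [aa wac E]] := sqr_complement wa.
have [an _] := rnorm_pythagoras wa aa wac (sqr_ge0 _) E.
by rewrite -E addrC addKr; apply: le_trans (rnormM _ _) _; rewrite -expr2.
Qed.

Lemma psd_sqr w : adj w = w -> psd (w * w).
Proof.
move=> wa; split; first by rewrite adjM wa.
by exists (rnorm w ^+ 2); [exact: sqr_ge0 | exact: rnorm_sqr_le].
Qed.

(** * Positivity of [b^* b] *)

(** With [s = ||v||^2], split [(m + s) z] as [(m z + v^2 z) + (s - v^2) z]; the last term has norm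
    at most [s ||z||]. *)
Lemma rnorm_le_addsqr v z m : adj v = v -> 0 <= m ->
  m * rnorm z <= rnorm (m *! z + v * v * z).
Proof.
move=> va m0; set s := rnorm v ^+ 2.
have s0 : 0 <= s by exact: sqr_ge0.
have E : (m + s) *! z = (m *! z + v * v * z) + (s *! \1 - v * v) * z.
  by rewrite mulrBl -scaleAl mul1r -addrA [v * v * z + _]addrC subrK -scaler_rD.
have := rnormZ z (addr_ge0 m0 s0); rewrite E => Ez.
have := rnormD (m *! z + v * v * z) ((s *! \1 - v * v) * z).
have := rnormM (s *! \1 - v * v) z.
have := rnorm_sqr_le va; rewrite -/s.
by have := rnorm_ge0 z; nra.
Qed.

(* For [h = w^2] and [m = ||h||], the identity [x (m - h) = (m + v^2) x] and the
   previous lemma give [m^2 <= 2 ||(m - h) h||], whereas [||(m - h) h|| <= m^2 / 4]. *)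
Lemma adjM_eq_opp_sqr x w v : adj w = w -> adj v = v ->
  adj x * x = - (w * w) -> x * adj x = v * v -> x = 0.
Proof.
move=> wa va xw xv; have [a [aa wac E]] := sqr_complement wa.
set m := rnorm w ^+ 2 in E *.
have m0 : 0 <= m by exact: sqr_ge0.
have [_ n2] := rnorm_pythagoras wa aa wac m0 E.
have hm : rnorm (w * w) = m by rewrite -{1}wa rnorm_adjM.
have xm : rnorm x ^+ 2 = m by rewrite -rnorm_adjM xw rnormN.
(* Since [a^2 = m - h], the element [f] is [(m - h) h], and it equals [(w a)^2]. *)
set h := w * w in xw hm E *; set f := a * a * h.
have fE : m *! h = f + h * h.
  by rewrite /f addrC -mulrDl E -scaleAl mul1r.
have fn : rnorm f <= m ^+ 2 / 4.
  have -> : f = (w * a) * (w * a).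
    by rewrite /f /h wac -!mulrA [w * (a * w)]mulrA wac -mulrA.
  by apply: le_trans (rnormM _ _) _; have := rnorm_ge0 (w * a); nra.
have xf : x * f = m *! (x * h) + v * v * (x * h).
  rewrite -xv -!mulrA [adj x * _]mulrA xw mulNr mulrN.
  by rewrite scaleAr fE mulrDr addrK.
have fx : m *! h = f - adj x * (x * h) by rewrite mulrA xw mulNr opprK.
have n3 : m * rnorm (x * h) <= rnorm x * rnorm f.
  by apply: le_trans (rnormM x f); rewrite xf rnorm_le_addsqr.
have n4 : m * m <= rnorm f + rnorm x * rnorm (x * h).
  rewrite -{2}hm -rnormZ // fx; apply: le_trans (rnormB _ _) _.
  by apply: lerD => //; apply: le_trans (rnormM _ _) _; rewrite rnorm_adj.
have n5 : m * (m * m) <= m * rnorm f + m * rnorm f.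
  apply: le_trans (_ : m * (rnorm f + rnorm x * rnorm (x * h)) <= _).
    by rewrite ler_wpM2l.
  rewrite mulrDr; apply: lerD => //.
  rewrite mulrCA -{2}xm expr2 -[leRHS]mulrA; apply: ler_wpM2l n3.
  exact: rnorm_ge0.
(* By [n5] and [fn], [m^3 <= m^3 / 2]. *)
have mE : m = 0.
  apply/le_anti; rewrite m0 andbT leNgt; apply/negP => mp.
  by have := mulr_gt0 mp (mulr_gt0 mp mp); have := ler_wpM2l m0 fn; lra.
by apply/rnorm0_eq0/eqP; rewrite -sqrf_eq0 xm mE.
Qed.

(** Up to sign, [p] and [q] are twice the real and imaginary parts of [x]; doubling the left side
    avoids fractions. *)
Lemma adj_mulDr_sqr x : exists p q, [/\ adj p = p, adj q = q &
  (x * adj x + adj x * x) + (x * adj x + adj x * x) = p * p + q * q].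
Proof.
exists (x + adj x), ('i%C *: (x - adj x)); split.
- by rewrite adjD adjK addrC.
- rewrite Defs.adjZ adjB adjK -opprB scalerN -scaleNr.
  by congr (_ *: _); rewrite /= /GRing.opp /= opprK oppr0.
- rewrite -scaleAl -scaleAr scalerA -['i%C * _]expr2 sqr_i scaleN1r.
  rewrite mulrBl !mulrBr !mulrDl !mulrDr.
  set a := x * x; set b := x * adj x; set c := adj x * x.
  set d := adj x * adj x.
  rewrite !opprB [c - d + _]addrC [RHS]addrACA [a + b]addrC [LHS]addrACA.
  by rewrite [b + a + _]addrACA [c + d + _]addrACA !subrr !addr0.
Qed.

(* Fukamiya-Kelley-Vaught: with [g = |h|] for [h = b^* b] and [q = g - h]
   (twice the negative part of [h]), [x = b q] has [x^* x <= 0 <= x x^*], so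
   [x = 0]. *)
Lemma psd_adjM b : psd (adj b * b).
Proof.
set h := adj b * b.
have ha : adj h = h by rewrite adjM adjK.
have [g [gp gg gc]] := psd_sqrt (psd_sqr ha).
have hg : h * g = g * h by apply: gc; rewrite mulrA.
have [ga _] := gp.
(* The root [s] of [g] turns [x^* x = q h q = - q g q] into minus the square of the self-adjoint
   [s q]. *)
have [s [[sa _] ss sc]] := psd_sqrt gp.
have hs : h * s = s * h by exact: sc.
have gs : g * s = s * g by exact: sc.
set q := g - h.
have qa : adj q = q by rewrite adjB ga ha.
have qs : q * s = s * q by rewrite mulrBl mulrBr hs gs.
have hq : h * q = - (g * q) by rewrite !mulrBr hg opprB gg.
have wa : adj (s * q) = s * q by rewrite adjM qa sa.
have xx : adj (b * q) * (b * q) = - (s * q * (s * q)).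
  rewrite adjM qa -mulrA [adj b * _]mulrA -/h hq mulrN -ss.
  by rewrite !mulrA qs.
have [v [[va _] vv _]] : exists v, [/\ psd v, v * v = b * q * adj (b * q) &
    forall z, z * (b * q * adj (b * q)) = b * q * adj (b * q) * z ->
      z * v = v * z].
  (* Adding [2 (s q)^2 = - 2 x^* x] to the sum of squares [2 (x x^* + x^* x)] leaves [2 x x^*]. *)
  apply: psd_sqrt; apply: psd_half.
  have [p [r [pa ra E]]] := adj_mulDr_sqr (b * q).
  have pw := psd_sqr wa.
  have := psdD (psdD (psd_sqr pa) (psd_sqr ra)) (psdD pw pw).
  by rewrite -E xx addrACA !subrK.
have x0 := adjM_eq_opp_sqr wa va xx (esym vv).
have w0 : s * q = 0.
  apply: rnorm0_eq0; apply/eqP; rewrite -sqrf_eq0 -rnorm_adjM wa.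
  by have := xx; rewrite x0 mulr0 => /esym/eqP;
    rewrite oppr_eq0 => /eqP->; rewrite rnorm0.
(* Indeed [q^2 = (g - h) q = 2 g q = 2 s (s q) = 0]. *)
have q0 : q = 0.
  apply: rnorm0_eq0; apply/eqP; rewrite -sqrf_eq0 -rnorm_adjM qa.
  by rewrite {1}/q mulrBl hq opprK -ss -mulrA w0 mulr0 addr0 rnorm0.
by have <- : g = h by apply/eqP; rewrite -subr_eq0 -/q q0.
Qed.

(** * The positive cone and the inner product *)

Lemma cstar_posP h : cstar_pos h <-> psd h.
Proof.
split=> [[a _ <-]|/psd_sqrt[a [[aa _] <- _]]]; first exact: psd_adjM.
by exists a => //; rewrite -/(adj a) aa.
Qed.

Lemma cstar_pos0 : cstar_pos (0 : A).
Proof. by exists 0 => //; rewrite mulr0. Qed.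

Lemma cstar_posD h k : cstar_pos h -> cstar_pos k -> cstar_pos (h + k).
Proof. by move=> /cstar_posP hp /cstar_posP kp; apply/cstar_posP/psdD. Qed.

Lemma cstar_pos_inner (d : nat) (u : 'rV[A]_d) : cstar_pos (mod_inner u u).
Proof.
apply: (big_ind (@cstar_pos R A)); first exact: cstar_pos0.
  exact: cstar_posD.
by move=> j _; exists (adj (u ord0 j)) => //; rewrite -/(adj _) adjK.
Qed.

Lemma mod_inner0 (d : nat) : mod_inner (0 : 'rV[A]_d) 0 = 0.
Proof. by rewrite /mod_inner big1 // => j _; rewrite mxE mul0r. Qed.

End CStarPositive.

Theorem theorem2p4 (R : realType) (A : unitalCStarAlgebra R)
    (d n : nat) (hd : (0 < d)%N) (hn : (0 < n)%N)
    (theta : R) (htheta0 : 0 <= theta) (htheta : theta < 2 * pi)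
    (tau : 'I_n -> 'rV[A]_d) (htau : modular_code theta tau)
    (c : R) (hc : 0 < c)
    (phi : A -> R)
    (hphi_sum : 0 <= \sum_(j < n) \sum_(k < n)
        phi (mod_inner (tau j - tau k) (tau j - tau k)))
    (hphi_neg : forall a : A, cstar_pos a ->
        cstar_le (cstar_real A (2 * (1 - cos theta))) a -> phi a + c <= 0) :
  n%:R <= (phi 0 + c) / c /\ (phi 0 + c <= 1 -> n%:R <= 1 / c).
Proof.
have [_ far] := htau.
have n0 : 0 < n%:R :> R by rewrite ltr0n.
have row j : \sum_(k < n) phi (mod_inner (tau j - tau k) (tau j - tau k)) <=
    phi 0 + c - n%:R * c.
  (* Removing the diagonal term [phi 0] leaves [c - n c = - (n - 1) c] as the bound for the other
     [n - 1] terms. *)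
  rewrite (bigD1 j) //= subrr mod_inner0 -addrA lerD2l.
  apply: (@le_trans _ _ (\sum_(k < n | k != j) - c)).
    apply: ler_sum => k kj; rewrite -subr_le0 opprK.
    by apply: hphi_neg; [exact: cstar_pos_inner | apply: far; rewrite eq_sym].
  rewrite sumr_const cardC1 card_ord -[_ *+ n.-1]mulr_natl mulrN.
  have -> : n%:R = n.-1%:R + 1 :> R by rewrite natr1 prednK.
  lra.
have main : n%:R * c <= phi 0 + c.
  have : 0 <= n%:R * (phi 0 + c - n%:R * c).
    apply: le_trans hphi_sum (le_trans (ler_sum _ (fun j _ => row j)) _).
    by rewrite sumr_const card_ord -[leLHS]mulr_natl lexx.
  by rewrite pmulr_rge0 // subr_ge0.
split; first by rewrite ler_pdivlMr.
by move=> h1; rewrite ler_pdivlMr //; apply: le_trans h1.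
Qed.
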